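(* Suppose $\Gamma,a,\Delta\vdash M$ is derivable and $\Gamma,a,\Delta\vdash M\rightsquigarrow_{\alpha_2}\Gamma,b,\Delta\vdash\Uparrow_{\Delta}\!\langle\pi_b\,,\,b\backslash a\rangle\circ M$; then $\Gamma,b,\Delta\vdash\Uparrow_{\Delta}\!\langle\pi_b\,,\,b\backslash a\rangle\circ M$ is derivable.
   Context: Calculus $\lambda\pi$: terms $M,N::= a\mid MN\mid\lambda a.M\mid s\circ M$, substitutions $s,q::= id\mid\pi_a\mid\langle s\,,\,N\backslash a\rangle\mid s\circ q$ ($\langle s\,,\,N\backslash a\rangle$ = $s$ extended by ''$N$ for $a$''); $s\circ q\circ M$ means $s\circ(q\circ M)$. Contexts are finite lists of variables with repetitions. Derivable judgements: (i) $\Gamma,a\vdash a$; (ii) $\Gamma\vdash a\Rightarrow\Gamma,b\vdash a$ ($a\neq b$); (iii) $\Gamma\vdash M,\Gamma\vdash N\Rightarrow\Gamma\vdash MN$; (iv) $\Gamma,a\vdash M\Rightarrow\Gamma\vdash\lambda a.M$; (v) $\Gamma\vdash s\triangleright\Delta,\Delta\vdash M\Rightarrow\Gamma\vdash s\circ M$; (vi) $\Gamma\vdash id\triangleright\Gamma$; (vii) $\Gamma,a\vdash\pi_a\triangleright\Gamma$; (viii) $\Gamma\vdash s\triangleright\Delta,\Gamma\vdash N\Rightarrow\Gamma\vdash\langle s\,,\,N\backslash a\rangle\triangleright\Delta,a$; (ix) $\Gamma\vdash s\triangleright\Delta,\Delta\vdash q\triangleright\Sigma\Rightarrow\Gamma\vdash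 s\circ q\triangleright\Sigma$. Define $\Uparrow_{nil}(s)\equiv s$ and $\Uparrow_{\Sigma,a}(s)\equiv\langle\pi_a\circ\Uparrow_\Sigma(s)\,,\,a\backslash a\rangle$. The rule $(\alpha_2)$ on judgements is $\Gamma,a,\Delta\vdash M\rightsquigarrow\Gamma,b,\Delta\vdash\Uparrow_{\Delta}\!\langle\pi_b\,,\,b\backslash a\rangle\circ M$, applicable when $a$ occurs free in the judgement $a,\Delta\vdash M$ and $b$ does not (free variables in the level-indexed sense of the paper). *)

(* Defs.v *)
From mathcomp Require Import all_boot.
Set Implicit Arguments.
Unset Strict Implicit.
Unset Printing Implicit Defensive.

(* [Clos s M] is s o M, [Ext s N a] is < s , N \ a >, [Comp s q] is s o q. *)
Inductive term (V : eqType) : Type :=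
  | Var of V
  | App of term V & term V
  | Lam of V & term V
  | Clos of subst V & term V
with subst (V : eqType) : Type :=
  | Id
  | Pi of V
  | Ext of subst V & term V & V
  | Comp of subst V & subst V.

Arguments Id {V}.

(* Contexts grow on the right on paper; here the rightmost variable is the head
   of the list, so "G, a" is [a :: G] and "G, a, D" is [D ++ a :: G]. *)
Definition ctx (V : eqType) := seq V.

Inductive der_term (V : eqType) : ctx V -> term V -> Prop :=
  | der_var G a : der_term (a :: G) (Var a)
  | der_weak G a b : a <> b -> der_term G (Var a) -> der_term (b :: G) (Var a)
  | der_app G M N : der_term G M -> der_term G N -> der_term G (App M N)
  | der_lam G a M : der_term (a :: G) M -> der_term G (Lam a M)
  | der_clos G D s M :
      der_subst G s D -> der_term D M -> der_term G (Clos s M)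
(* [der_subst G s D] is the judgement  G |- s |> D. *)
with der_subst (V : eqType) : ctx V -> subst V -> ctx V -> Prop :=
  | der_id G : der_subst G Id G
  | der_pi G a : der_subst (a :: G) (Pi a) G
  | der_ext G D s N a :
      der_subst G s D -> der_term G N -> der_subst G (Ext s N a) (a :: D)
  | der_comp G D S s q :
      der_subst G s D -> der_subst D q S -> der_subst G (Comp s q) S.

Fixpoint up_subst (V : eqType) (S : ctx V) (s : subst V) : subst V :=
  if S is a :: S' then Ext (Comp (Pi a) (up_subst S' s)) (Var a) a else s.

(* Since contexts may repeat variables, a free variable carries a level: (a, n)
   stands for the n-th occurrence of a in the context, counted from the right
   and starting at 0, i.e. for Pi a o ... o Pi a o a with n copies of Pi a. *)
Definition lvar (V : eqType) : eqType := (V * nat)%type.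

Definition shift_lvar (V : eqType) (a : V) (x : lvar V) : lvar V :=
  if x.1 == a then (a, x.2.+1) else x.

(* Binding a captures (a, 0) and turns (a, n.+1) into (a, n). *)
Definition unbind_lvar (V : eqType) (a : V) (X : seq (lvar V)) : seq (lvar V) :=
  pmap (fun x : lvar V =>
          if x.1 == a then (if x.2 is n.+1 then Some (a, n) else None)
          else Some x) X.

(* [fv_subst s (fv M)] lists the free variables of s o M. *)
Fixpoint fv (V : eqType) (M : term V) : seq (lvar V) :=
  match M with
  | Var a => [:: (a, 0)]
  | App M N => fv M ++ fv N
  | Lam a M => unbind_lvar a (fv M)
  | Clos s M => fv_subst s (fv M)
  end
with fv_subst (V : eqType) (s : subst V) (X : seq (lvar V)) : seq (lvar V) :=
  match s with
  | Id => X
  | Pi a => map (shift_lvar a) X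
  | Ext s N a => fv_subst s (unbind_lvar a X) ++ fv N
  | Comp s q => fv_subst s (fv_subst q X)
  end.

(* The context of a judgement binds: G |- M has the free variables of the
   abstraction of M over all of G, the rightmost variable innermost. *)
Definition fv_judgement (V : eqType) (G : ctx V) (M : term V) : seq (lvar V) :=
  foldl (fun X a => unbind_lvar a X) (fv M) G.

Definition occurs_free (V : eqType) (a : V) (G : ctx V) (M : term V) : Prop :=
  exists n : nat, (a, n) \in fv_judgement G M.

(* In the side conditions, [rcons D a] is the context "a, D". *)
Inductive alpha2 (V : eqType) : ctx V * term V -> ctx V * term V -> Prop :=
  | Alpha2 (G D : ctx V) (a b : V) (M : term V) :
      occurs_free a (rcons D a) M ->
      ~ occurs_free b (rcons D a) M ->
      alpha2 (D ++ a :: G, M)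
             (D ++ b :: G, Clos (up_subst D (Ext (Pi b) (Var b) a)) M).

(* Main.v *)
Require Import Defs.
From mathcomp Require Import all_boot.

(** The renaming [Ext (Pi b) (Var b) a] leads from [b :: G] to [a :: G]: [Pi b] drops [b], and
    [Var b] fills the slot [a]. Lifting over [D] preserves this ([der_up_subst]), so the closure
    rule applies to [M]. *)

Lemma der_up_subst (V : eqType) (G H D : ctx V) (s : subst V) :
  der_subst G s H -> der_subst (D ++ G) (up_subst D s) (D ++ H).
Proof.
move=> der_s; elim: D => [//|c D IHD] /=.
(* [Pi c] leads from [c :: D ++ G] to [D ++ G], where the induction hypothesis takes over; [Var c]
   refills the head slot. *)
by apply: der_ext; [apply: der_comp IHD; apply: der_pi | apply: der_var].
Qed.

Theorem mainTheorem2 (V : eqType) (G D : ctx V) (a b : V) (M : term V) :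
  der_term (D ++ a :: G) M ->
  alpha2 (D ++ a :: G, M)
         (D ++ b :: G, Clos (up_subst D (Ext (Pi b) (Var b) a)) M) ->
  der_term (D ++ b :: G) (Clos (up_subst D (Ext (Pi b) (Var b) a)) M).
Proof.
move=> derM _; apply: der_clos derM; apply: der_up_subst.
by apply: der_ext; [apply: der_pi | apply: der_var].
Qed.
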